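(* Let $X$ be a Polish space with $|X|\ge 2$, let $\mathcal{I}$ be an ideal on $\omega$, and let $\nu:\mathcal{P}(\omega)\to\mathbb{R}$ be the diffuse submeasure $\nu:=\mathbf{1}_{\mathcal{I}^+}$, that is, $\nu(A)=1$ if $A\notin\mathcal{I}$ and $\nu(A)=0$ if $A\in\mathcal{I}$. Then the following are equivalent: (i) for every $\alpha\in(0,1)$ there exists a function $g_\alpha:\omega\to\omega$ such that for every $A\subseteq\omega$ with $\nu(\omega\setminus A)\le 1-\alpha$ there exists $n_{\alpha,A}\in\omega$ such that $A\cap[n,n+g_\alpha(n)]\neq\emptyset$ for all $n\ge n_{\alpha,A}$; (ii) $\mathcal{I}$ is meager (as a subset of $\mathcal{P}(\omega)$ identified with the Cantor space $2^\omega$); (iii) the set $\Sigma_\nu(X)$ of $\nu$-maldistributed sequences is comeager in $X^\omega$.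
   Context: $\omega$ is the set of nonnegative integers; intervals such as $[n,m]$ denote intervals of integers in $\omega$. An ideal on $\omega$ is a family $\mathcal{I}\subseteq\mathcal{P}(\omega)$ closed under finite unions and subsets, containing all finite subsets of $\omega$, and with $\omega\notin\mathcal{I}$. Set $\mathcal{I}^+:=\mathcal{P}(\omega)\setminus\mathcal{I}$. Identifying $\mathcal{P}(\omega)$ with the Cantor space $2^\omega$ (via characteristic functions), $\mathcal{I}$ is called meager if it is a meager subset of $2^\omega$. A diffuse submeasure is a map $\nu:\mathcal{P}(\omega)\to\mathbb{R}$ that is monotone ($\nu(A)\le\nu(B)$ for $A\subseteq B\subseteq\omega$), subadditive ($\nu(A\cup B)\le\nu(A)+\nu(B)$ for all $A,B\subseteq\omega$), and satisfies $\nu(F)=0$ and $\nu(\omega\setminus F)=1$ for all finite $F\subseteq\omega$. Given a topological space $X$, a sequence $\mathbf{x}=(x_n:n\in\omega)\in X^\omega$ is $\nu$-maldistributed if $\nu(\{n\in\omega:x_n\in U\})=1$ for all nonempty open sets $U\subseteq X$. Define $\Sigma_\nu(X):=\{\mathbf{x}\in X^\omega:\mathbf{x}\text{ is }\nu\text{-maldistributed}\}$, where $X^\omega$ carries the product topology. A set is meager if it is contained in a countable union of closed sets with empty interior, and comeager if its complement is meager. *)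

(* Defs.v *)
From HB Require Import structures.
From mathcomp Require Import all_boot all_order all_algebra.
From mathcomp Require Import all_classical all_reals all_analysis.

Set Implicit Arguments.
Unset Strict Implicit.
Unset Printing Implicit Defensive.

Import Order.TTheory GRing.Theory Num.Theory.
Import numFieldNormedType.Exports.

Local Open Scope classical_set_scope.
Local Open Scope ring_scope.

Record is_ideal (I : set (set nat)) : Prop := {
  ideal_sub : forall A B, A `<=` B -> I B -> I A;
  ideal_setU : forall A B, I A -> I B -> I (A `|` B);
  ideal_finite : forall A, finite_set A -> I A;
  ideal_proper : ~ I setT }.

Record is_diffuse_submeasure (R : realType) (nu : set nat -> R) : Prop := {
  submeasure_mono : forall A B, A `<=` B -> nu A <= nu B;
  submeasure_setU : forall A B, nu (A `|` B) <= nu A + nu B;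
  submeasure_finite : forall F, finite_set F -> nu F = 0;
  submeasure_cofinite : forall F, finite_set F -> nu (~` F) = 1 }.

Definition ideal_submeasure (R : realType) (I : set (set nat)) : set nat -> R :=
  \1_(~` I).

Lemma ideal_submeasureP (R : realType) (I : set (set nat)) :
  is_ideal I -> is_diffuse_submeasure (ideal_submeasure R I).
Proof.
move=> [Isub IU Ifin IT]; rewrite /ideal_submeasure.
have nuE A : \1_(~` I) A = (~~ `[< I A >])%:R :> R.
  by rewrite indicE in_setC; congr (~~ _)%:R; rewrite [in LHS]/in_mem/=.
split=> [A B AB|A B|F finF|F finF]; rewrite !nuE.
- rewrite ler_nat; case: asboolP => //= nIA; case: asboolP => //= IB.
  by case: nIA; exact: Isub IB.
- rewrite -natrD ler_nat; case: asboolP => //= nIAB.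
  case: asboolP => //= IA; case: asboolP => //= IB.
  by case: nIAB; exact: IU.
- by rewrite asboolT//; exact: Ifin.
- rewrite asboolF// => IF; apply: IT; rewrite -(setUv F).
  by apply: IU => //; exact: Ifin.
Qed.

Definition meager (T : topologicalType) (A : set T) : Prop :=
  exists2 F : nat -> set T,
    (forall n, closed (F n) /\ interior (F n) = set0) & A `<=` \bigcup_n F n.

Definition comeager (T : topologicalType) (A : set T) : Prop := meager (~` A).

Definition meager_ideal (I : set (set nat)) : Prop :=
  meager [set f : cantor_space | I [set n | f n]].

Record is_metric (R : realType) (X : Type) (d : X -> X -> R) : Prop := {
  metric_ge0 : forall x y, 0 <= d x y;
  metric_eq0 : forall x y, d x y = 0 <-> x = y;
  metric_symmetric : forall x y, d x y = d y x;
  metric_triangular : forall x y z, d x z <= d x y + d y z }.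

Definition separable (X : topologicalType) : Prop :=
  exists2 D : set X, countable D & dense D.

Definition completely_metrizable (R : realType) (X : topologicalType) : Prop :=
  exists d : X -> X -> R, [/\ is_metric d,
    (forall (x : X) (U : set X), nbhs x U <->
       exists2 e, 0 < e & [set y | d x y < e] `<=` U) &
    (forall u : nat -> X,
       (forall e, 0 < e -> exists N, forall m n,
          (N <= m)%N -> (N <= n)%N -> d (u m) (u n) < e) ->
       exists l : X, u @ \oo --> l)].

Definition polish (R : realType) (X : topologicalType) : Prop :=
  separable X /\ completely_metrizable R X.

Definition maldistributed (R : realType) (nu : set nat -> R)
    (X : topologicalType) (x : nat -> X) : Prop :=
  forall U : set X, open U -> U !=set0 -> nu [set n | U (x n)] = 1.

(* The explicit [prod_topology] forces the product topology on sequences. *)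
Definition Sigma (R : realType) (nu : set nat -> R) (X : topologicalType) :
    set (prod_topology (fun _ : nat => X)) :=
  [set x | maldistributed nu x].

Arguments Sigma {R} nu X.

(* Main.v *)
(* Since nu only takes the values 0 and 1, (i) says that for some g no set of I
   contains infinitely many of the intervals [n, n + g n].

   From (i), I and the complement of Sigma are covered by countably many sets of
   sequences that leave an open set B in each interval [n, n + g n] with n >= N;
   these are closed with empty interior (for Sigma, B ranges over a countable
   pi-base of X).

   Conversely, (ii) gives (i) by Talagrand's argument. For (iii) => (ii), take
   disjoint nonempty open U, W with dense union. If the F_n cover the complement
   of Sigma, a Baire category argument in U^nat * W^nat yields (u, w) such that
   the continuous map sending e in 2^nat to the sequence equal to u_i when
   e_i = 1 and to w_i otherwise pulls each F_n back to a nowhere dense set; that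
   map sends I outside Sigma, because e is the set of indices landing in U. *)
Require Import Defs.
From HB Require Import structures.
From mathcomp Require Import all_boot all_order all_algebra.
From mathcomp Require Import all_classical all_reals all_analysis.
From mathcomp Require Import lra.
Import Order.TTheory GRing.Theory Num.Theory.
Import numFieldNormedType.Exports.
Local Open Scope classical_set_scope.
Local Open Scope ring_scope.

(** * Boxes and nowhere dense sets in countable powers *)

Definition box {X : Type} (M : nat) (C : nat -> set X) :
    set {ptws nat -> X} :=
  [set z | forall i, (i < M)%N -> C i (z i)].

Lemma box_open {X : topologicalType} (M : nat) (C : nat -> set X) :
  (forall i, open (C i)) -> open (box M C).
Proof.
move=> oC; rewrite -closedC.
rewrite (_ : ~` _ = \bigcup_(i in `I_M) (proj i @^-1` ~` C i)).
  apply: closed_bigcup => // i _; apply: preimage_closed.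
    by move=> x _; exact: proj_continuous.
  by rewrite closedC.
apply/seteqP; split=> [z /existsNP[i /not_implyP[iM nC]]|z [i iM nC]].
  by exists i.
by move=> /(_ i iM).
Qed.

(** The product topology is a supremum of initial topologies, so the filter generated by the boxes
    around [y] need only converge to [y] coordinate by coordinate. *)
Lemma nbhs_box {X : topologicalType} (y : {ptws nat -> X})
    (O : set {ptws nat -> X}) : nbhs y O ->
  exists M (C : nat -> set X),
    (forall i, open (C i) /\ C i (y i)) /\ box M C `<=` O.
Proof.
pose G : set_system {ptws nat -> X} := [set O | exists M (C : nat -> set X),
  (forall i, open (C i) /\ C i (y i)) /\ box M C `<=` O].
have FG : Filter G.
  split.
  - by exists 0%N, (fun=> setT); split=> // i; split=> //; exact: openT.
  - move=> P Q [M [C [oC CP]]] [N [D [oD DQ]]].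
    exists (maxn M N), (fun i => C i `&` D i); split.
      move=> i; have [? ?] := oC i; have [? ?] := oD i.
      by split => //; exact: openI.
    move=> z zCD; split.
      by apply: CP => i iM; apply: (zCD i _).1; rewrite leq_max iM.
    by apply: DQ => i iN; apply: (zCD i _).2; rewrite leq_max iN orbT.
  - move=> P Q PQ [M [C [oC CP]]]; exists M, C; split => //.
    exact: subset_trans PQ.
suff: G --> y by apply.
apply/cvg_sup => i U [V [[W oW <-] Wy WU]].
exists i.+1, (fun j => [set u | j = i -> W u]); split.
  move=> j; have [->|ji] := pselect (j = i).
    rewrite (_ : [set u | _] = W) //.
    by apply/seteqP; split=> [u|u Wu _//]; exact.
  rewrite (_ : [set u | _] = setT); first by split => //; exact: openT.
  by apply/seteqP; split=> u // _ /ji.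
by move=> z zW; apply: WU; exact: zW (ltnSn i) erefl.
Qed.

Lemma interior_ptws_eq0 {X : topologicalType} (F : set {ptws nat -> X}) :
  (forall y M, exists2 z, (forall i, (i < M)%N -> z i = y i) & ~ F z) ->
  F° = set0.
Proof.
move=> nF; apply/seteqP; split=> // y /nbhs_box[M [C [oC CF]]].
have [z zy] := nF y M; apply; apply: CF => i iM.
by rewrite zy//; exact: (oC i).2.
Qed.

Lemma box_avoid {X : topologicalType} (F : set {ptws nat -> X}) (M : nat)
    (C : nat -> set X) :
  F° = set0 -> (forall i, open (C i) /\ C i !=set0) ->
  exists2 z, box M C z & ~ F z.
Proof.
move=> F0 oC; apply: contrapT => /forall2NP CF.
have /choice[z Cz] : forall i, exists u, C i u by move=> i; exact: (oC i).2.
suff : F° z by rewrite F0.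
apply: (_ : box M C `<=` F°); last by move=> i _; exact: Cz.
rewrite -open_subsetE; last by apply: box_open => i; exact: (oC i).1.
by move=> w Cw; have [//|/contrapT] := CF w.
Qed.

Definition misses {X : Type} (B : set X) (g : nat -> nat) (N : nat) :
    set {ptws nat -> X} :=
  [set x | forall n, (N <= n)%N -> exists2 i, (n <= i <= n + g n)%N & ~ B (x i)].

(** For each [n] the condition is a finite union of closed cylinders. *)
Lemma misses_closed {X : topologicalType} (B : set X) g N :
  open B -> closed (misses B g N).
Proof.
move=> oB.
rewrite (_ : misses B g N = \bigcap_(n in [set n | (N <= n)%N])
    \bigcup_(i in [set i | (n <= i <= n + g n)%N]) (proj i @^-1` ~` B)).
  apply: closed_bigI => n _; apply: closed_bigcup => [|i _].
    apply: (@sub_finite_set _ _ `I_(n + g n).+1) => [i /= /andP[_]|].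
      by rewrite ltnS.
    exact: finite_II.
  apply: preimage_closed => [x _|]; first exact: proj_continuous.
  by rewrite closedC.
apply/seteqP; split=> x xB n Nn; have [i ni nB] := xB n Nn; by exists i.
Qed.

Lemma misses_interior {X : topologicalType} (B : set X) g N :
  B !=set0 -> (misses B g N)° = set0.
Proof.
move=> [b Bb]; apply: interior_ptws_eq0 => y M.
exists (fun i => if (i < M)%N then y i else b) => [i ->//|].
move=> /(_ (maxn M N) (leq_maxr _ _))[i /andP[+ _]].
by rewrite geq_max => /andP[Mi _]; rewrite ltnNge Mi.
Qed.

(** * Finite patterns avoiding nowhere dense sets of the Cantor space *)

Definition splice {X : Type} (n : nat) (t f : nat -> X) : nat -> X :=
  fun i => if (i < n)%N then t i else f i.

(** The pairs are treated one by one: the pattern built so far, put behind the head [t], extends to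
    a point outside [E], and as [E] is closed finitely many bits of that point suffice to stay
    outside. *)
Lemma avoiding_pattern (n : nat) (L : seq (set cantor_space * (nat -> bool))) :
  (forall E t, (E, t) \in L -> closed E /\ E° = set0) ->
  exists m s, forall f : nat -> bool,
    (forall i, (n <= i < m)%N -> f i = s i) ->
    forall E t, (E, t) \in L -> ~ E (splice n t f).
Proof.
elim: L => [_|[E t] L IH EL].
  by exists n, (fun=> false).
have [|m [s sL]] := IH; first by move=> E' t' EtL; apply: (EL E' t'); rewrite inE EtL orbT.
have [cE E0] := EL E t (mem_head _ _).
have [y ys nEy] : exists2 y,
    box (maxn n m) (fun i => [set splice n t s i]) y & ~ E y.
  apply: box_avoid => // i; split; first exact: discrete_open.
  by exists (splice n t s i).
have /nbhs_box[k [C [oC CE]]] : nbhs (y : cantor_space) (~` E).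
  by apply: open_nbhs_nbhs; split => //; rewrite openC.
exists (maxn m k), y => f fy E' t'; rewrite inE => /orP[/eqP[-> ->]|]; last first.
  apply: sL => i /andP[ni im]; rewrite fy ?ni/= ?leq_max ?im//.
  by rewrite (ys i) ?leq_max ?im ?orbT// /splice ltnNge ni.
apply: CE => i ik; rewrite (_ : splice n t f i = y i); first exact: (oC i).2.
rewrite {1}/splice; case: ltnP => ni.
  by rewrite (ys i) ?leq_max ?ni// /splice ni.
by rewrite fy// ni leq_max ik orbT.
Qed.

(** Only finitely many pairs are at stake: the [F k] with [k <= n] and the Boolean heads of length
    [n]. Hence the pattern works whatever bits precede it. *)
Lemma meager_avoiding_pattern (F : nat -> set cantor_space) :
  (forall n, closed (F n) /\ (F n)° = set0) ->
  forall n, exists m s, forall f : nat -> bool,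
    (forall i, (n <= i < m)%N -> f i = s i) ->
    forall k, (k <= n)%N -> ~ F k f.
Proof.
move=> cF n.
pose L := [seq (F k, nth false t) | k <- iota 0 n.+1,
  t <- [seq val u | u <- enum {: n.-tuple bool}]].
have [|m [s sL]] := @avoiding_pattern n L.
  by move=> E t /allpairsP[[k u] [_ _ [-> _]]]; exact: cF.
exists m, s => f fs k kn.
have := sL f fs (F k) (nth false (mkseq f n)).
rewrite (_ : splice _ _ _ = f); last first.
  by apply/funext => i; rewrite /splice; case: ltnP => // ?; rewrite nth_mkseq.
apply; apply/allpairsP; exists (k, mkseq f n); split => //.
  by rewrite mem_iota add0n ltnS.
have nf : size (mkseq f n) == n by rewrite size_mkseq.
by apply/mapP; exists (Tuple nf) => //; rewrite mem_enum.
Qed.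

(** * Condition (i) and meager ideals *)

Lemma ideal_submeasure1P (R : realType) (I : set (set nat)) (A : set nat) :
  ideal_submeasure R I A = 1 <-> ~ I A.
Proof.
rewrite /ideal_submeasure indicE; split=> [|nIA]; last by rewrite mem_set.
by case: (boolP (A \in ~` I)) => [/set_mem//|_ /esym/eqP]; rewrite oner_eq0.
Qed.

Lemma ideal_submeasure0P (R : realType) (I : set (set nat)) (A : set nat) :
  ideal_submeasure R I A < 1 <-> I A.
Proof.
split=> [|IA]; last by rewrite /ideal_submeasure indicE memNset//; exact.
by apply: contraPP => /(ideal_submeasure1P R) ->; rewrite ltxx.
Qed.

Definition meets_intervals (I : set (set nat)) (g : nat -> nat) : Prop :=
  forall B, I B -> exists N, forall n, (N <= n)%N ->
    exists2 i, (n <= i <= n + g n)%N & ~ B i.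

Lemma meets_intervalsP (R : realType) (I : set (set nat)) :
  (forall alpha : R, 0 < alpha < 1 ->
    exists g : nat -> nat, forall A : set nat,
      ideal_submeasure R I (~` A) <= 1 - alpha ->
    exists N : nat, forall n : nat, (N <= n)%N ->
      A `&` [set k | (n <= k <= n + g n)%N] !=set0) <->
  exists g, meets_intervals I g.
Proof.
(* One value of [alpha] suffices: for [alpha] in (0, 1), being at most [1 - alpha] forces the value
   0. *)
split=> [/(_ 2^-1)[]|[g gI] alpha /andP[a0 a1]].
- by rewrite invr_gt0 ltr0n invf_lt1 ?ltr1n.
- move=> g gA; exists g => B IB; have [|N BN] := gA (~` B).
    rewrite setCK /ideal_submeasure indicE memNset; last exact.
    by rewrite subr_ge0 invf_le1 ?ler1n.
  by exists N => n /BN[k [nB nk]]; exists k.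
- exists g => A nuA; have [|N AN] := gI (~` A).
    apply/(ideal_submeasure0P R); apply: le_lt_trans nuA _.
    by rewrite ltrBlDr ltrDl.
  by exists N => n /AN[k nk /contrapT Ak]; exists k.
Qed.

Lemma meets_intervals_meager (I : set (set nat)) (g : nat -> nat) :
  meets_intervals I g -> meager_ideal I.
Proof.
move=> gI; exists (misses [set true] g) => [N|f /= If].
  split; first by apply: misses_closed; exact: discrete_open.
  by apply: misses_interior; exists true.
by have [N fN] := gI _ If; exists N => // n /fN.
Qed.

(* Talagrand and Jalali-Naini: if [B] contained infinitely many of the intervals
   [[n, n + m n]], a subset of [B] could follow the avoiding patterns on
   infinitely many of them, hence escape every [F n]. *)
Lemma meager_meets_intervals (I : set (set nat)) :
  is_ideal I -> meager_ideal I -> exists g, meets_intervals I g.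
Proof.
move=> [Isub _ _ _] [F cF IF].
have /choice[m /choice[s sF]] := meager_avoiding_pattern _ cF.
(* [m n] is the end of the pattern starting at [n], not its length; [[n, n + m n]] contains
   [[n, m n)]. *)
exists m => B IB; apply: contrapT => /forallNP nB.
have /choice[h hB] : forall N, exists n, (N <= n)%N /\
    forall i, (n <= i <= n + m n)%N -> B i.
  move=> N; have /existsNP[n /not_implyP[Nn nBn]] := nB N.
  exists n; split => // i ni; apply: contrapT => nBi; apply: nBn.
  by exists i.
(* Starting points of pairwise disjoint intervals contained in [B]. *)
pose fix a k := if k is k'.+1 then h (a k' + m (a k')).+1 else h 0.
have a_lt k l : (k < l)%N -> (a k + m (a k) < a l)%N.
  elim: l => // l IH; rewrite ltnS leq_eqVlt => /orP[/eqP ->|/IH kl].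
    by have [] := hB (a l + m (a l)).+1.
  have [al _] := hB (a l + m (a l)).+1.
  by apply: leq_trans kl (leq_trans _ al); rewrite ltnW// ltnS leq_addr.
have a_ge k : (k <= a k)%N.
  elim: k => // k kak; apply: leq_ltn_trans kak _.
  exact: leq_ltn_trans (leq_addr _ _) (a_lt _ _ (ltnSn k)).
have aB k i : (a k <= i <= a k + m (a k))%N -> B i.
  by case: k => [|k]; exact: (hB _).2.
pose f : cantor_space := fun i =>
  `[< exists2 k, (a k <= i <= a k + m (a k))%N & s (a k) i >].
have fB : [set i | f i] `<=` B.
  by move=> i /asboolP[k ki _]; exact: aB ki.
(* Since [k <= a k], the pattern starting at [a k] avoids [F k]. *)
have [k _] := IF f (Isub _ _ fB IB); apply: (sF (a k)) (a_ge k).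
move=> i /andP[ki im].
have {im}ki' : (a k <= i <= a k + m (a k))%N.
  by rewrite ki /= ltnW// (leq_trans im)// leq_addl.
(* By disjointness, only the pattern of index [k] decides the bit [i]. *)
apply/asboolP/idP => [[l li]|sl]; last by exists k.
have [kl|lk|->//] := ltngtP k l.
  move: li (a_lt _ _ kl) => /andP[al _] akl.
  by move/andP: ki' => [_ /leq_ltn_trans/(_ akl)]; rewrite ltnNge al.
move: li (a_lt _ _ lk) => /andP[_ al] akl.
by move: (leq_ltn_trans al akl); rewrite ltnNge ki.
Qed.

(** * Metric preliminaries *)

Definition compatible_metric {R : realType} {X : topologicalType}
    (d : X -> X -> R) : Prop :=
  is_metric d /\ forall (x : X) (U : set X), nbhs x U <->
    exists2 e, 0 < e & [set y | d x y < e] `<=` U.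

Lemma metric_ball_open {R : realType} {X : topologicalType} (d : X -> X -> R)
    (x : X) (r : R) : compatible_metric d -> open [set y | d x y < r].
Proof.
move=> [[_ _ _ dT] dn]; rewrite openE => y /= xy.
apply/dn; exists (r - d x y) => [|z /= yz]; first by rewrite subr_gt0.
by apply: le_lt_trans (dT x y z) _; rewrite -ltrBrDl.
Qed.

Lemma compatible_metric_hausdorff {R : realType} {X : topologicalType}
    (d : X -> X -> R) : compatible_metric d -> hausdorff_space X.
Proof.
move=> [[d0 d00 ds dT] dn] x y xy.
apply/d00/eqP; rewrite eq_le d0 andbT leNgt; apply/negP => dxy.
have e0 : 0 < d x y / 2 by rewrite divr_gt0.
have [z []/=] : [set z | d x z < d x y / 2] `&`
    [set z | d y z < d x y / 2] !=set0.
  by apply: xy; apply/dn; exists (d x y / 2).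
by move=> xz yz; have := dT x z y; rewrite (ds z y); lra.
Qed.

Lemma metric_shrink {R : realType} {X : topologicalType} (d : X -> X -> R)
    (A : set X) (e : R) : compatible_metric d -> 0 < e -> open A -> A !=set0 ->
  exists B : set X, [/\ open B, B !=set0, closure B `<=` A &
    forall u v, B u -> B v -> d u v < e].
Proof.
move=> dX e0 oA [c Ac]; have [[d0 d00 ds dT] dn] := dX.
have [r r0 rA] : exists2 r, 0 < r & [set y | d c y < r] `<=` A.
  by apply/dn; exact: open_nbhs_nbhs.
have m0 : 0 < Num.min r e by rewrite lt_min r0.
have mr : Num.min r e <= r by rewrite ge_min lexx.
have me : Num.min r e <= e by rewrite ge_min lexx orbT.
set m := Num.min r e in m0 mr me.
(* Half the radius: closure points stay within [m <= r] of [c], and two points of the ball are less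
   than [m <= e] apart. *)
exists [set y | d c y < m / 2]; split.
- exact: metric_ball_open.
- by exists c => /=; rewrite (d00 c c).2// divr_gt0.
- move=> y yB; apply: rA => /=.
  have [z [/= cz yz]] : [set z | d c z < m / 2] `&`
      [set z | d y z < m / 2] !=set0.
    by apply: yB; apply/dn; exists (m / 2) => //; rewrite divr_gt0.
  by have := dT c z y; rewrite (ds z y); lra.
- by move=> u v /= cu cv; have := dT u c v; rewrite (ds u c); lra.
Qed.

(** Balls of radius [1 / (i + 1)] around a dense sequence, with [setT] as default for numbers that
    code no pair. *)
Lemma separable_pi_base {R : realType} {X : topologicalType} (d : X -> X -> R) :
  compatible_metric d -> separable X -> (exists x : X, True) ->
  exists B : nat -> set X, (forall k, open (B k) /\ B k !=set0) /\
    forall U, open U -> U !=set0 -> exists k, B k `<=` U.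
Proof.
move=> dX [D cD dD] [x0 _]; have [[d0 d00 ds dT] dn] := dX.
have [a Da] : exists a : nat -> X, D `<=` range a.
  have /pfcard_geP[D0|[f]] := cD.
    by exists (fun=> x0); rewrite D0.
  by exists f => x Dx; have [n _ <-] := 'surj_f Dx; exists n.
pose B k := if unpickle k is Some (n, i)
  then [set y | d (a n) y < (i : nat).+1%:R^-1] else setT.
exists B; split=> [k|U oU [x Ux]].
  rewrite /B; case: unpickle => [[n i]|]; last first.
    by split; [exact: openT|exists x0].
  by split; [exact: metric_ball_open|exists (a n) => /=; rewrite (d00 _ _).2].
have [e e0 eU] : exists2 e, 0 < e & [set y | d x y < e] `<=` U.
  by apply/dn; exact: open_nbhs_nbhs.
have [i ie] : exists i, 0 + i.+1%:R^-1 < e / 2.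
  by apply: ltr_add_invr; rewrite divr_gt0.
rewrite add0r in ie.
have [y [xy Dy]] : [set y | d x y < i.+1%:R^-1] `&` D !=set0.
  apply: dD; last exact: metric_ball_open.
  by exists x => /=; rewrite (d00 x x).2.
have [n _ any] := Da y Dy; exists (pickle (n, i)).
rewrite /B pickleK any => z yz; apply: eU; move: ie xy yz => /=.
move: (i.+1%:R^-1) => r re xy yz.
by have := dT x y z; lra.
Qed.

(** * Baire category in a product, and generic selections *)

(** Nonempty basic open boxes relative to the product of the [V t]: only finitely many indices [i]
    are constrained. *)
Definition positive_boxes {X : topologicalType} {T : Type} (V : T -> set X)
    (p : nat -> T -> set X) : Prop :=
  (forall i t, open (p i t) /\ p i t !=set0) /\
  exists M, forall i, (M <= i)%N -> p i = V.

(* The Baire category theorem for [X ^ (nat * T)], by hand: stage [k] meets the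
   requirement [Q k], then shrinks the coordinates [(i, t)] with [i < k]. *)
Lemma generic_point {R : realType} {X : topologicalType} {T : Type}
    (V : T -> set X) (Q : nat -> set (nat -> T -> X)) :
  completely_metrizable R X ->
  (forall t, open (V t) /\ V t !=set0) ->
  (forall k p, positive_boxes V p -> exists q, [/\ positive_boxes V q,
    (forall i t, q i t `<=` p i t) &
    forall x, (forall i t, q i t (x i t)) -> Q k x]) ->
  exists x : nat -> T -> X, (forall i t, V t (x i t)) /\ forall k, Q k x.
Proof.
move=> [d [dm dn dc]] oV QV; have dX : compatible_metric d by [].
have /choice[next nextP] : forall kp : nat * (nat -> T -> set X), exists q,
    positive_boxes V kp.2 -> [/\ positive_boxes V q,
      (forall i t, q i t `<=` kp.2 i t),
      (forall x, (forall i t, q i t (x i t)) -> Q kp.1 x) &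
      forall i t, (i < kp.1)%N -> closure (q i t) `<=` kp.2 i t /\
        forall u v, q i t u -> q i t v -> d u v < kp.1.+1%:R^-1].
  move=> [k p] /=; have [pV|pV] := pselect (positive_boxes V p); last by exists p.
  have [q [[oq [M qM]] qp qQ]] := QV k p pV.
  have /choice[r rP] : forall it : nat * T, exists B : set X,
      [/\ open B, B !=set0, closure B `<=` q it.1 it.2 &
      forall u v, B u -> B v -> d u v < k.+1%:R^-1].
    move=> [i t]; have [? ?] := oq i t.
    by apply: metric_shrink; rewrite ?invr_gt0.
  (* Shrinking only [i < k] leaves almost all coordinates at [V], yet every coordinate is shrunk at
     all stages [k > i]. *)
  pose q' i t := if (i < k)%N then r (i, t) else q i t.
  have q'q i t : q' i t `<=` q i t.
    rewrite /q'; case: ifP => [_ x rx|_ x //]; have [_ _ rq _] := rP (i, t).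
    by apply: rq; exact: subset_closure.
  exists q' => _; split.
  - split=> [i t|]; first by rewrite /q'; case: ifP => // _; have [] := rP (i, t).
    exists (maxn M k) => i; rewrite geq_max => /andP[Mi ki].
    by apply/funext => t; rewrite /q' ltnNge ki qM.
  - by move=> i t; apply: subset_trans (qp i t).
  - by move=> x xq; apply: qQ => i t; exact: q'q.
  - move=> i t ik; rewrite /q' ik; have [_ _ rq rd] := rP (i, t).
    by split => //; exact: subset_trans (qp i t).
pose fix p k := if k is k'.+1 then next (k', p k') else (fun=> V).
have pV k : positive_boxes V (p k).
  elim: k => [|k IH]; last by have [] := nextP (k, p k) IH.
  by split=> [i t|]; [exact: oV|exists 0%N].
have pS k i t : p k.+1 i t `<=` p k i t.
  by have [_ pS _ _] := nextP (k, p k) (pV k); exact: pS.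
have p_le k l i t : (k <= l)%N -> p l i t `<=` p k i t.
  move=> kl; rewrite -(subnK kl); elim: (l - k)%N => // n IH.
  by apply: subset_trans IH; rewrite addSn; exact: pS.
have /choice[c cP] : forall kit : nat * nat * T,
    exists c, p kit.1.1 kit.1.2 kit.2 c.
  by move=> [[k i] t]; exact: ((pV k).1 i t).2.
have /choice[x xc] : forall it : nat * T, exists l : X,
    (fun k => c (k, it.1, it.2)) @ \oo --> l.
  move=> [i t] /=; apply: dc => e e0.
  have [N] : exists N, 0 + N.+1%:R^-1 < e by exact: ltr_add_invr.
  (* Stage [maxn i.+1 N] exceeds [i], so it does shrink coordinate [i], to diameter below
     [1 / (N + 1)]. *)
  rewrite add0r => Ne; exists (maxn i.+1 N).+1 => m n mN nN.
  have [_ _ _ /(_ i t)[|_ pd]] := nextP (maxn i.+1 N, p (maxn i.+1 N)) (pV _).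
    by rewrite /= leq_max ltnSn.
  apply: lt_trans (lt_le_trans (pd _ _ _ _) _) Ne.
  - by apply: (p_le _ _ _ _ mN); exact: (cP (m, i, t)).
  - by apply: (p_le _ _ _ _ nN); exact: (cP (n, i, t)).
  - by rewrite lef_pV2 ?posrE// ler_nat ltnS leq_maxr.
(* The limit lies in the closure of a later box, which is inside the earlier one. *)
have xp k i t : p k i t (x (i, t)).
  apply: (p_le _ _ _ _ (leq_maxl k i.+1)).
  have [_ _ _ /(_ i t)[|+ _]] := nextP (maxn k i.+1, p (maxn k i.+1)) (pV _).
    by rewrite /= leq_max ltnSn orbT.
  apply; apply: (closed_cvg _ (@closed_closure _ _) _ _ (xc (i, t))).
  exists (maxn k i.+1).+1 => // n /= kn; apply: subset_closure.
  by apply: (p_le _ _ _ _ kn); exact: (cP (n, i, t)).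
exists (fun i t => x (i, t)); split=> [i t|k]; first exact: (xp 0%N).
by have [_ _ + _] := nextP (k, p k) (pV k); apply => i t; exact: (xp k.+1).
Qed.

(** One of two separating open sets, and its exterior: an open set disjoint from the first is also
    disjoint from its closure. *)
Lemma hausdorff_disjoint_opens {X : topologicalType} :
  hausdorff_space X -> (exists x y : X, x <> y) ->
  exists V : bool -> set X, [/\ forall b, open (V b) /\ V b !=set0,
    V true `&` V false = set0 &
    forall O, open O -> O !=set0 -> exists b, (O `&` V b) !=set0].
Proof.
rewrite open_hausdorff => hX [x [y /eqP xy]].
have [[A B] /= [xA yB] [oA oB /eqP AB]] := hX x y xy.
exists (fun b => if b then A else ~` closure A); split.
- case; first by split => //; exists x; exact: set_mem.
  split; first by rewrite openC; exact: closed_closure.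
  exists y => /= /(_ B); rewrite AB => -[]//.
  by apply: open_nbhs_nbhs; split => //; exact: set_mem.
- by apply/seteqP; split=> // z [Az]; apply; exact: subset_closure.
- move=> O oO [z Oz]; have [OA|OA] := pselect (O `&` A !=set0).
    by exists true.
  exists false, z; split => // /(_ O) AO; apply: OA; rewrite setIC; apply: AO.
  by apply: open_nbhs_nbhs.
Qed.

Definition select {X : Type} (x : nat -> bool -> X) (e : cantor_space) :
  {ptws nat -> X} := fun i => x i (e i).

Lemma select_continuous {X : topologicalType} (x : nat -> bool -> X) :
  continuous (select x).
Proof.
move=> e; apply/cvg_sup => i U [W [[W' oW <-] We WU]].
rewrite nbhs_filterE; apply: (filterS WU).
have : nbhs e (proj i @^-1` [set e i] : set cantor_space).
  apply: (@proj_continuous _ (fun=> bool) i e).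
  by apply: open_nbhs_nbhs; split; first exact: discrete_open.
apply: filterS => f fe; change (W' (x i (f i))).
by rewrite (fe : f i = e i).
Qed.

(* Kuratowski-Ulam for the map [(x, e) |-> select x e] on
   (V true)^nat * (V false)^nat * 2^nat: the requirements on [x] say that no
   cylinder of the Cantor space is mapped into some [F n]. Density of the union
   of the [V b] is what lets a cylinder be prolonged so as to leave [F n]. *)
Lemma generic_select {R : realType} {X : topologicalType} (V : bool -> set X)
    (F : nat -> set {ptws nat -> X}) :
  completely_metrizable R X -> (forall b, open (V b) /\ V b !=set0) ->
  (forall O, open O -> O !=set0 -> exists b, (O `&` V b) !=set0) ->
  (forall n, closed (F n) /\ (F n)° = set0) ->
  exists x : nat -> bool -> X, (forall i b, V b (x i b)) /\
    forall n, (select x @^-1` F n)° = set0.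
Proof.
move=> cX oV dV cF.
(* [k] codes an index [n] and a cylinder [t], some point of which must be sent outside [F n]. *)
pose Q k := [set x : nat -> bool -> X | if unpickle k is Some (n, t) then
  exists2 e : cantor_space, forall i, (i < size t)%N -> e i = nth false t i &
    ~ F n (select x e) else True].
have [k p|x [xV xQ]] := generic_point V Q cX oV; last first.
  exists x; split=> // n; apply: interior_ptws_eq0 => y M.
  have := xQ (pickle (n, mkseq y M)); rewrite /Q/= pickleK size_mkseq.
  move=> [e ey nF].
  by exists e => // i iM; rewrite ey// nth_mkseq.
rewrite /Q; case: unpickle => [[n t]|pV]; last by exists p; split=> // i t.
move=> [op [M pM]]; have [cFn Fn0] := cF n.
have [y yp nFy] : exists2 y,
    box (maxn M (size t)) (fun i => p i (nth false t i)) y & ~ F n y.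
  by apply: box_avoid => // i; exact: op.
have /nbhs_box[N [C [oC CF]]] : nbhs y (~` F n).
  by apply: open_nbhs_nbhs; split => //; rewrite openC.
(* Below [maxn M (size t)] the bits follow [t], padded with [false], and [y] itself is in the
   intersection; beyond, [p i] is [V] and density provides the bit. *)
have /choice[e eP] : forall i, exists b, (C i `&` p i b) !=set0 /\
    ((i < size t)%N -> b = nth false t i).
  move=> i; have [im|im] := ltnP i (maxn M (size t)).
    exists (nth false t i); split => //; exists (y i).
    by split; [exact: (oC i).2|exact: yp].
  have [oCi Cy] := oC i.
  have [b Cb] := dV _ oCi (ex_intro _ _ Cy).
  move: im; rewrite geq_max => /andP[Mi ti].
  by exists b; rewrite (pM i Mi) ltnNge ti.
(* Shrinking the selected entries below [N] forces [select x e] into the box around [y] that avoids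
   [F n]. *)
exists (fun i b => if (i < N)%N && (b == e i) then C i `&` p i b else p i b).
split.
- split=> [i b|].
    case: ifPn => [/andP[_ /eqP->]|_ //].
    split; last exact: (eP i).1.
    by apply: openI; [exact: (oC i).1|exact: (op _ _).1].
  exists (maxn M N) => i; rewrite geq_max => /andP[Mi Ni].
  by apply/funext => b; rewrite ltnNge Ni pM.
- by move=> i b; case: ifP => [_ x []|_ x].
- move=> x xq; exists e => [i|]; first exact: (eP i).2.
  by apply: CF => i iN; have := xq i (e i); rewrite iN eqxx => -[].
Qed.

(** * Comeagerness of [Sigma] and the equivalences *)

(** If [U] witnesses that [x] is not maldistributed, some [B l] lies inside [U], so the visits of
    [x] to [B l] also form a set of [I]. *)
Lemma meets_intervals_comeager {R : realType} {X : topologicalType}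
    (I : set (set nat)) (g : nat -> nat) :
  polish R X -> (exists x : X, True) -> is_ideal I -> meets_intervals I g ->
  comeager (Sigma (ideal_submeasure R I) X).
Proof.
move=> [sX [d [dm dn _]]] X0 [Isub _ _ _] gI.
have [B [oB dB]] := separable_pi_base d (conj dm dn) sX X0.
exists (fun k => if unpickle k is Some (l, N) then misses (B l) g N else set0).
  move=> k; case: unpickle => [[l N]|]; last first.
    by split; [exact: closed0|exact: interior0].
  have [oBl Bl0] := oB l.
  by split; [exact: misses_closed|exact: misses_interior].
move=> x /existsNP[U /not_implyP[oU /not_implyP[U0 /(ideal_submeasure1P R)]]].
move=> /contrapT IU; have [l BU] := dB U oU U0.
have IB : I [set n | B l (x n)] by apply: Isub IU => n; exact: BU.
have [N xN] := gI _ IB.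
by exists (pickle (l, N)) => //; rewrite pickleK.
Qed.

Lemma comeager_Sigma_meager_ideal {R : realType} {X : topologicalType}
    (I : set (set nat)) :
  polish R X -> (exists x y : X, x <> y) ->
  comeager (Sigma (ideal_submeasure R I) X) -> meager_ideal I.
Proof.
move=> [_ cX] X2 [F cF SF].
have hX : hausdorff_space X.
  by have [d [dm dn _]] := cX; exact: (compatible_metric_hausdorff d (conj dm dn)).
have [V [oV VV dV]] := hausdorff_disjoint_opens hX X2.
have [x [xV xF]] := generic_select V F cX oV dV cF.
exists (fun n => select x @^-1` F n) => [n|e /= Ie].
  split=> //; apply: preimage_closed (cF n).1 => ? _.
  exact: select_continuous.
apply: SF => /(_ (V true) (oV true).1 (oV true).2)/(ideal_submeasure1P R); apply.
rewrite (_ : [set n | _] = [set n | e n])//; apply/seteqP; split=> n /=.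
  rewrite /select; case: (e n) => // Vx.
  by have : (V true `&` V false) (x n false) by []; rewrite VV.
by rewrite /select => ->.
Qed.

Theorem theorem1p2 (R : realType) (X : topologicalType) (I : set (set nat))
    (X_polish : polish R X) (X_ge2 : exists x y : X, x <> y)
    (I_ideal : is_ideal I) :
  let nu := ideal_submeasure R I in
  let i := forall alpha : R, 0 < alpha < 1 ->
    exists g : nat -> nat, forall A : set nat, nu (~` A) <= 1 - alpha ->
    exists N : nat, forall n : nat, (N <= n)%N ->
      A `&` [set k | (n <= k <= n + g n)%N] !=set0 in
  let ii := meager_ideal I in
  let iii := comeager (Sigma nu X) in
  (i <-> ii) /\ (ii <-> iii).
Proof.
move=> nu i ii iii.
(* The existence of [g] is the hub through which both equivalences pass. *)
have iE : i <-> exists g, meets_intervals I g by exact: meets_intervalsP.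
have ii_g : ii -> exists g, meets_intervals I g by exact: meager_meets_intervals.
split; split.
- by move=> /iE[g gI]; exact: meets_intervals_meager gI.
- by move=> /ii_g/iE.
- move=> /ii_g[g gI]; apply: meets_intervals_comeager gI => //.
  by have [x _] := X_ge2; exists x.
- exact: comeager_Sigma_meager_ideal.
Qed.
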